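(* For all $A,B>0$ and any $\varepsilon\in(0,2)$, the Szlenk derivation $s_\varepsilon B_{\ell_{\mathcal{M}_{A,B}}}$ is not a ball, where $\ell_{\mathcal{M}_{A,B}}$ is regarded as the dual of $\ell_{\mathcal{M}_{A,B}}^\ast$. In particular, the space $\ell_{\mathcal{M}_{A,B}}^\ast$ fails property $(M^\ast)$.
   Context: For $A,B>0$ let $\mathcal{M}_{A,B}(t)=At^4+Bt^2$ ($t\geq0$). The Orlicz sequence space $\ell_{\mathcal{M}_{A,B}}$ consists of real sequences $x=(x_n)$ with $\sum_n\mathcal{M}_{A,B}(|x_n|/\lambda)<\infty$ for some $\lambda>0$, with norm $\|x\|=\inf\{\lambda>0\colon\sum_n\mathcal{M}_{A,B}(|x_n|/\lambda)\leq1\}$. It is isomorphic to $\ell_2$, hence reflexive, so it is identified with the dual of $\ell_{\mathcal{M}_{A,B}}^\ast$. For a Banach space $X$, $B_{X^\ast}=\{x^\ast\in X^\ast\colon\|x^\ast\|\leq1\}$, and for $\varepsilon\in(0,2)$ its $\varepsilon$-Szlenk derivation is $$s_\varepsilon B_{X^\ast}=\{x^\ast\in B_{X^\ast}\colon\operatorname{diam}(B_{X^\ast}\cap V)>\varepsilon\text{ for every weak}^\ast\text{-open neighborhood }V\text{ of }x^\ast\},$$ with diameters taken in the norm of $X^\ast$. Here $X=\ell_{\mathcal{M}_{A,B}}^\ast$ and $X^\ast=\ell_{\mathcal{M}_{A,B}}$. ''Ball'' means a closed norm ball. A separable Banach space $X$ has property $(M^\ast)$ if for all $x^\ast,y^\ast\in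 X^\ast$ with $\|x^\ast\|=\|y^\ast\|$ and every weak$^\ast$-null sequence $(u_n^\ast)_{n=1}^\infty\subset X^\ast$, one has $\limsup_n\|x^\ast+u_n^\ast\|=\limsup_n\|y^\ast+u_n^\ast\|$. *)

(* Defs.v *)
From HB Require Import structures.
From mathcomp Require Import all_boot all_order all_algebra.
From mathcomp Require Import all_classical all_reals all_analysis.
From mathcomp Require Import ring lra.

Set Implicit Arguments.
Unset Strict Implicit.
Unset Printing Implicit Defensive.

Import Order.TTheory GRing.Theory Num.Theory.
Import numFieldNormedType.Exports.

Local Open Scope classical_set_scope.
Local Open Scope ring_scope.

(* Only the values on [0, +oo[ matter: an Orlicz function is always applied to
   `|x n| / l below. *)
Record orliczFun (R : realType) := OrliczFun {
  orlicz_fun :> R -> R ;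
  orlicz0 : orlicz_fun 0 = 0 ;
  orlicz_homo : {in Num.nneg &, {homo orlicz_fun : s t / s <= t}} ;
  orlicz_convex : @convex_function R R^o [set t | 0 <= t] orlicz_fun ;
  orlicz_pinfty : orlicz_fun t @[t --> +oo] --> +oo }.

Section OrliczSpace.
Context {R : realType} (M : orliczFun R).
Implicit Types (x y : nat -> R) (l m : R).

Definition orlicz_modular l x : \bar R :=
  (\sum_(0 <= n <oo) (M (`|x n| / l))%:E)%E.
Local Notation rho := orlicz_modular.

Definition orlicz_pred : {pred nat -> R} :=
  mem [set x : nat -> R | exists2 l, 0 < l & (rho l x < +oo)%E].

Record orliczSpace := OrliczSpace {
  orlicz_seq :> nat -> R ;
  orlicz_seqP : orlicz_seq \in orlicz_pred }.

HB.instance Definition _ := [isSub for orlicz_seq].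
HB.instance Definition _ := [Choice of orliczSpace by <:].

Let M_ge0 t : 0 <= t -> 0 <= M t.
Proof.
by move=> t0; rewrite -[leLHS](orlicz0 M) orlicz_homo// nnegrE.
Qed.

Let normV_ge0 (a l : R) : 0 < l -> 0 <= `|a| / l.
Proof. by move=> l0; rewrite divr_ge0// ltW. Qed.

Let rho_ge0 l x : 0 < l -> (0 <= rho l x)%E.
Proof.
by move=> l0; apply: nneseries_ge0 => n _ _; rewrite lee_fin M_ge0 ?normV_ge0.
Qed.

Let rho_conv l m x y : 0 < l -> 0 < m ->
  (rho (l + m) (x + y)%R <=
     (l / (l + m))%:E * rho l x + (m / (l + m))%:E * rho m y)%E.
Proof.
move=> l0 m0; have lm0 : 0 < l + m by rewrite addr_gt0.
have a0 : 0 <= l / (l + m) by rewrite divr_ge0// ltW.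
have b0 : 0 <= m / (l + m) by rewrite divr_ge0// ltW.
have a1 : l / (l + m) <= 1 by rewrite ler_pdivrMr// mul1r lerDl ltW.
rewrite -!nneseriesZl; last 2 first.
- by move=> n _; rewrite lee_fin M_ge0 ?normV_ge0.
- by move=> n _; rewrite lee_fin M_ge0 ?normV_ge0.
rewrite -nneseriesD; last 2 first.
- by move=> n _ _; rewrite -EFinM lee_fin mulr_ge0// M_ge0 ?normV_ge0.
- by move=> n _ _; rewrite -EFinM lee_fin mulr_ge0// M_ge0 ?normV_ge0.
apply: lee_nneseries => [n _ _|n _]; first by rewrite lee_fin M_ge0 ?normV_ge0.
rewrite -!EFinM -EFinD lee_fin.
have tin : Itv.spec (@Itv.num_sem R) (Itv.Real `[0%Z, 1%Z]) (l / (l + m)).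
  by apply/and3P; split; rewrite ?num_real// bnd_simp.
pose t : {i01 R} := Itv.mk tin.
have tE : t%:num = l / (l + m) by [].
have ob : 1 - t%:num = m / (l + m).
  by rewrite tE; field; rewrite gt_eqF.
have := @orlicz_convex R M t (`|x n| / l) (`|y n| / m).
rewrite !inE/= !normV_ge0// => /(_ erefl erefl).
rewrite [X in M X <= _ -> _](_ : _ = (`|x n| + `|y n|) / (l + m)); last first.
  rewrite -[LHS]/(t%:num * (`|x n| / l) + (1 - t%:num) * (`|y n| / m)) ob tE.
  field.
  by rewrite !gt_eqF.
rewrite convRE /= /unstable.onem ob.
apply: le_trans.
apply: orlicz_homo; rewrite ?nnegrE.
- exact: normV_ge0.
- by rewrite divr_ge0 ?addr_ge0// ltW.
- by rewrite ler_pM2r ?invr_gt0// ler_normD.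
Qed.

Let rhoZ a l x : a != 0 -> 0 < l -> rho (`|a| * l) (a *: x) = rho l x.
Proof.
move=> a0 l0; rewrite /rho; apply: eq_eseriesr => n _; congr ((M _)%:E).
rewrite /GRing.scale/= normrM -mulf_div divff ?mul1r// normr_eq0//.
Qed.

Let rho0 l : rho l 0 = 0%E.
Proof. by apply: eseries0 => n _ _; rewrite normr0 mul0r orlicz0. Qed.

Let rho_shrink k l x : 0 < l -> 1 < k -> (rho (k * l) x <= k^-1%:E * rho l x)%E.
Proof.
move=> l0 k1.
have m0 : 0 < (k - 1) * l by rewrite mulr_gt0// subr_gt0.
have := @rho_conv l ((k - 1) * l) x 0 l0 m0.
rewrite addr0 rho0 mule0 adde0.
have -> : l + (k - 1) * l = k * l by ring.
suff -> : l / (k * l) = k^-1 by [].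
by field; rewrite !gt_eqF// (lt_trans _ k1).
Qed.

Lemma orlicz_submod : submod_closed orlicz_pred.
Proof.
split; first by rewrite inE/=; exists 1 => //; rewrite rho0.
move=> a x y; rewrite !inE /= => -[l l0 xl] [m m0 ym].
have [->|a0] := eqVneq a 0; first by rewrite scale0r add0r; exists m.
have al0 : 0 < `|a| * l by rewrite mulr_gt0// normr_gt0.
exists (`|a| * l + m); first by rewrite addr_gt0.
apply: (le_lt_trans (rho_conv _ _ al0 m0)).
have lm0 : 0 < `|a| * l + m by rewrite addr_gt0.
rewrite rhoZ// lte_add_pinfty// lte_mul_pinfty ?lee_fin// ?divr_ge0// ltW//.
Qed.

HB.instance Definition _ :=
  GRing.isSubmodClosed.Build _ _ orlicz_pred orlicz_submod.
HB.instance Definition _ := [SubChoice_isSubLmodule of orliczSpace by <:].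

(* The index set of the infimum defining the Luxemburg norm; it is non-empty on
   orliczSpace by convexity. *)
Let luxset x := [set l | 0 < l /\ (rho l x <= 1)%E].

Definition luxemburg_norm (x : orliczSpace) : R :=
  inf [set l | 0 < l /\ (orlicz_modular l x <= 1)%E].

Let luxset_lb x : has_lbound (luxset x).
Proof. by exists 0 => l [/ltW]. Qed.

Let luxset_neq0 (x : orliczSpace) : luxset x !=set0.
Proof.
have := orlicz_seqP x; rewrite inE/= => -[l l0 xl].
have r0 := rho_ge0 x l0.
have rE : rho l x = (fine (rho l x))%:E by rewrite fineK// ge0_fin_numE.
have f0 : 0 <= fine (rho l x) by rewrite fine_ge0.
have k1 : 1 < fine (rho l x) + 2 by lra.
exists ((fine (rho l x) + 2) * l); split; first by rewrite mulr_gt0//; lra.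
apply: (le_trans (rho_shrink _ l0 k1)).
rewrite rE -EFinM lee_fin /= mulrC ler_pdivrMr; lra.
Qed.

Let lux_ge0 (x : orliczSpace) : 0 <= luxemburg_norm x.
Proof. by apply: lb_le_inf => [|l [/ltW]//]; exact: luxset_neq0. Qed.

Let luxD (x y : orliczSpace) :
  luxemburg_norm (x + y) <= luxemburg_norm x + luxemburg_norm y.
Proof.
apply/ler_addgt0Pr => e e0.
have e2 : 0 < e / 2 by rewrite divr_gt0.
have hx : has_inf (luxset x) by split; [exact: luxset_neq0|exact: luxset_lb].
have hy : has_inf (luxset y) by split; [exact: luxset_neq0|exact: luxset_lb].
have [l [l0 xl] le] := inf_adherent e2 hx.
have [m [m0 ym] me] := inf_adherent e2 hy.
apply: (@le_trans _ _ (l + m)); last first.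
  rewrite /luxemburg_norm; move: le me; rewrite /luxset; lra.
have lm0 : 0 < l + m by rewrite addr_gt0.
apply: ge_inf; [exact: luxset_lb|split=> //].
rewrite /= (le_trans (rho_conv _ _ l0 m0))//.
apply: (@le_trans _ _ ((l / (l + m))%:E * 1 + (m / (l + m))%:E * 1)%E).
  by rewrite leeD// lee_wpmul2l// lee_fin divr_ge0// ltW.
by rewrite !mule1 -EFinD lee_fin -mulrDl divff// gt_eqF.
Qed.

Let lux0 : luxemburg_norm 0 = 0.
Proof.
apply/eqP; rewrite eq_le lux_ge0 andbT; apply/ler_addgt0Pr => e e0.
by rewrite add0r; apply: ge_inf; [exact: luxset_lb|split=> //=; rewrite rho0].
Qed.

Let luxZ_le a (x : orliczSpace) : a != 0 -> luxemburg_norm (a *: x) <= `|a| * luxemburg_norm x.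
Proof.
move=> a0; have na0 : 0 < `|a| by rewrite normr_gt0.
rewrite -ler_pdivrMl//; apply: lb_le_inf => [|l [l0 xl]]; first exact: luxset_neq0.
rewrite ler_pdivrMl//; apply: ge_inf; [exact: luxset_lb|split; first by rewrite mulr_gt0].
by rewrite /= rhoZ.
Qed.

Let luxZ a (x : orliczSpace) : luxemburg_norm (a *: x) = `|a| * luxemburg_norm x.
Proof.
have [->|a0] := eqVneq a 0; first by rewrite scale0r lux0 normr0 mul0r.
apply/eqP; rewrite eq_le luxZ_le//=.
have ai0 : a^-1 != 0 by rewrite invr_eq0.
have := luxZ_le (a *: x) ai0.
by rewrite scalerA mulVf// scale1r normfV ler_pdivlMl ?normr_gt0.
Qed.

Let lux_eq0 (x : orliczSpace) : luxemburg_norm x = 0 -> x = 0.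
Proof.
move=> nx0; apply/val_inj/funext => n /=; apply/eqP/negP => /negP xn0.
have /cvgryPgt/(_ 1)[A [_ MA]] := orlicz_pinfty M.
have hx : has_inf (luxset x) by split; [exact: luxset_neq0|exact: luxset_lb].
have A0 : 0 < `|A| + 1 by rewrite ltr_wpDl.
have e0 : 0 < `|x n| / (`|A| + 1) by rewrite divr_gt0// normr_gt0.
have [l [l0 xl]] := inf_adherent e0 hx.
rewrite [X in X + _](_ : _ = 0) ?add0r; last exact: nx0.
rewrite ltr_pdivlMr// mulrC -ltr_pdivlMr// => lA.
have : A < `|x n| / l by apply: le_lt_trans lA; rewrite ler_wpDr// ler_norm.
move=> /MA; apply/negP; rewrite -leNgt -lee_fin; apply: le_trans xl.
rewrite /rho (@nneseriesD1 _ _ n)//; last first.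
  by move=> k _; rewrite lee_fin M_ge0 ?normV_ge0.
by rewrite leeDl// nneseries_ge0// => k _ _; rewrite lee_fin M_ge0 ?normV_ge0.
Qed.

HB.instance Definition _ := Lmodule_isNormed.Build R orliczSpace luxD luxZ lux_eq0.

End OrliczSpace.

Section QuarticOrlicz.
Context {R : realType} {A B : R} (A0 : 0 < A) (B0 : 0 < B).

Definition quartic (t : R) : R := A * t ^+ 4 + B * t ^+ 2.

Let quartic0 : quartic 0 = 0.
Proof. by rewrite /quartic !expr0n/= !mulr0 addr0. Qed.

Let quartic_homo : {in Num.nneg &, {homo quartic : s t / s <= t}}.
Proof.
move=> s t; rewrite !nnegrE => s0 t0 st.
by rewrite lerD// ler_wpM2l ?(ltW A0) ?(ltW B0)// lerXn2r.
Qed.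

Let conv_sqr (p a b : R) : 0 <= p -> p <= 1 ->
  (p * a + (1 - p) * b) ^+ 2 <= p * a ^+ 2 + (1 - p) * b ^+ 2.
Proof.
move=> p0 p1; rewrite -subr_ge0.
have -> : p * a ^+ 2 + (1 - p) * b ^+ 2 - (p * a + (1 - p) * b) ^+ 2 =
  p * (1 - p) * (a - b) ^+ 2 by ring.
by rewrite mulr_ge0 ?sqr_ge0// mulr_ge0// subr_ge0.
Qed.

Let quartic_convex : @convex_function R R^o [set t | 0 <= t] quartic.
Proof.
move=> p a b _ _.
rewrite [leLHS](_ : _ = quartic (p%:num * a + (1 - p%:num) * b))//.
rewrite [leRHS](_ : _ = p%:num * quartic a + (1 - p%:num) * quartic b)//.
have p0 : 0 <= p%:num by [].
have p1 : p%:num <= 1 by [].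
move: (p%:num) p0 p1 => {}p p0 p1.
have h2 := conv_sqr a b p0 p1.
have h4 := conv_sqr (a ^+ 2) (b ^+ 2) p0 p1.
have h4' : (p * a + (1 - p) * b) ^+ 4 <= p * a ^+ 4 + (1 - p) * b ^+ 4.
  rewrite !(exprM _ 2 2); apply: le_trans h4.
  by rewrite lerXn2r// nnegrE ?sqr_ge0// (le_trans _ h2)// sqr_ge0.
rewrite /quartic.
have -> : p * (A * a ^+ 4 + B * a ^+ 2) + (1 - p) * (A * b ^+ 4 + B * b ^+ 2) =
  A * (p * a ^+ 4 + (1 - p) * b ^+ 4) + B * (p * a ^+ 2 + (1 - p) * b ^+ 2).
  by ring.
by rewrite lerD// ler_wpM2l// ltW.
Qed.

Let quartic_pinfty : quartic t @[t --> +oo] --> +oo.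
Proof.
apply/cvgryPge => C; near=> t.
have t1 : 1 <= t by near: t; apply: nbhs_pinfty_ge; rewrite num_real.
have tC : C / B <= t by near: t; apply: nbhs_pinfty_ge; rewrite num_real.
have t0 : 0 <= t by exact: le_trans t1.
apply: (@le_trans _ _ (B * t)); first by rewrite mulrC -ler_pdivrMr.
apply: (@le_trans _ _ (B * t ^+ 2)).
  by rewrite ler_pM2l// expr2 ler_peMl.
by rewrite /quartic lerDr mulr_ge0 ?exprn_ge0// ltW.
Unshelve. all: by end_near. Qed.

Definition quarticOrlicz : orliczFun R :=
  OrliczFun quartic0 quartic_homo quartic_convex quartic_pinfty.

Definition ell_quartic := orliczSpace quarticOrlicz.
HB.instance Definition _ := NormedModule.on ell_quartic.

End QuarticOrlicz.

Section Dual.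
Context {R : realType} (X : normedModType R).

Definition continuous_linear_pred : {pred X -> R} :=
  mem [set f : X -> R | linear (f : X -> R^o) /\ continuous f].

(* The topological dual X^*, as the subspace of continuous linear forms of
   X -> R, with the operator norm dual_norm below. *)
Record dual := Dual {
  dual_fun :> X -> R ;
  dual_funP : dual_fun \in continuous_linear_pred }.

HB.instance Definition _ := [isSub for dual_fun].
HB.instance Definition _ := [Choice of dual by <:].

Lemma continuous_linear_submod : submod_closed continuous_linear_pred.
Proof.
split.
  rewrite inE/=; split; last exact: cst_continuous.
  by move=> a x y /=; rewrite scaler0 addr0.
move=> a f g; rewrite !inE/= => -[lf cf] [lg cg]; split.
  move=> k x y; rewrite !fctE /= lf lg !scalerDr !scalerA mulrC addrACA.
  by [].
move=> x; apply: cvgD; last exact: cg.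
by apply: cvgZr; exact: cf.
Qed.

HB.instance Definition _ :=
  GRing.isSubmodClosed.Build _ _ continuous_linear_pred continuous_linear_submod.
HB.instance Definition _ := [SubChoice_isSubLmodule of dual by <:].

Lemma dual_linear (f : dual) : linear (f : X -> R^o).
Proof. by have := dual_funP f; rewrite inE => -[]. Qed.

HB.instance Definition _ (f : dual) :=
  GRing.isLinear.Build R X R^o _ (dual_fun f) (@dual_linear f).

Lemma dual_continuous (f : dual) : continuous f.
Proof. by have := dual_funP f; rewrite inE => -[]. Qed.

Definition dual_norm (f : dual) : R :=
  sup [set `|f x| | x in [set x : X | `|x| <= 1]].

Let dual_set_neq0 (f : dual) : [set `|f x| | x in [set x : X | `|x| <= 1]] !=set0.
Proof. by exists `|f 0|; exists 0 => //=; rewrite normr0. Qed.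

Let dual_set_ub (f : dual) :
  has_ubound [set `|f x| | x in [set x : X | `|x| <= 1]].
Proof.
have /linear_bounded_continuous/linear_boundedP := @dual_continuous f.
move=> /pinfty_ex_gt0[r r0 fr]; exists r => _ [x /= x1 <-].
by apply: le_trans (fr x) _; rewrite ler_piMr// ltW.
Qed.

Let dual_norm_ge0 f : 0 <= dual_norm f.
Proof.
apply: (@le_trans _ _ `|f 0|) => //; apply: ub_le_sup => //.
by exists 0 => //=; rewrite normr0.
Qed.

Lemma dual_norm_ub (f : dual) x : `|f x| <= dual_norm f * `|x|.
Proof.
have [->|x0] := eqVneq x 0; first by rewrite linear0 !normr0 mulr0.
have nx0 : 0 < `|x| by rewrite normr_gt0.
rewrite -ler_pdivrMr//; apply: ub_le_sup => //.
exists (`|x|^-1 *: x).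
  by rewrite /= normrZ normfV normr_id mulVf// gt_eqF.
by rewrite linearZ/= normrM normfV normr_id mulrC.
Qed.

Let dual_normD f g : dual_norm (f + g) <= dual_norm f + dual_norm g.
Proof.
apply: ge_sup => // _ [x /= x1 <-].
rewrite (le_trans (ler_normD _ _))// lerD//; apply: ub_le_sup => //; by exists x.
Qed.

Let dual_normZ a f : dual_norm (a *: f) = `|a| * dual_norm f.
Proof.
apply/eqP; rewrite eq_le; apply/andP; split.
  apply: ge_sup => // _ [x /= x1 <-].
  by rewrite normrM ler_wpM2l//; apply: ub_le_sup => //; exists x.
have [->|a0] := eqVneq a 0; first by rewrite normr0 mul0r.
rewrite -ler_pdivlMl ?normr_gt0//; apply: ge_sup => // _ [x /= x1 <-].
rewrite ler_pdivlMl ?normr_gt0// -normrM.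
by apply: ub_le_sup => //; exists x.
Qed.

Let dual_norm_eq0 f : dual_norm f = 0 -> f = 0.
Proof.
move=> f0; apply/val_inj/funext => x /=; apply/eqP; rewrite -normr_le0.
by rewrite (le_trans (dual_norm_ub f x))// f0 mul0r.
Qed.

HB.instance Definition _ :=
  Lmodule_isNormed.Build R dual dual_normD dual_normZ dual_norm_eq0.

End Dual.

Section Bidual.
Context {R : realType} {X : normedModType R}.

Let evaluationP (x : X) :
  (fun f : dual X => f x) \in @continuous_linear_pred R (dual X).
Proof.
rewrite inE/=; have evl : linear (fun f : dual X => f x : R^o) by [].
split=> //.
pose ev : {linear dual X -> R^o} :=
  HB.pack (fun f : dual X => f x : R^o) (GRing.isLinear.Build _ _ _ _ _ evl).
apply: (@bounded_linear_continuous _ _ _ ev); apply/linear_boundedP.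
exists `|x|; split=> [|r /ltW xr f]; first by rewrite num_real.
by rewrite /= (le_trans (dual_norm_ub f x))// -[dual_norm f]/(`|f|) mulrC ler_wpM2r.
Qed.

(* The canonical isometric embedding of X into its bidual; when X is reflexive it
   is the identification of X with the dual of dual X. *)
Definition evaluation (x : X) : dual (dual X) := Dual (evaluationP x).

End Bidual.

Arguments evaluation {R} X x.

Section WeakStar.
Context {R : realType} (X : normedModType R).

(* dual X with the topology of pointwise convergence on X. A separate alias is
   needed because the canonical topology on dual X is the norm topology. *)
Definition weak_star : Type :=
  initial_topology (fun f : dual X => (f : {ptws X -> R})).

HB.instance Definition _ := Topological.on weak_star.

Definition dual_ball : set (dual X) := [set f | `|f| <= 1].

(* The ereal_sup is the norm diameter of dual_ball `&` V. *)
Definition szlenk_derivation (e : R) : set (dual X) :=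
  [set f | dual_ball f /\
     forall V : set weak_star, open V -> V f ->
       (e%:E < ereal_sup [set `|g - h|%:E |
         g in dual_ball `&` V & h in dual_ball `&` V])%E].

(* Property (M^* ) is usually considered for separable Banach spaces X; these two
   requirements on X are not part of the predicate, so that its negation is really
   the failure of the limsup identity. The limsups are taken in the extended
   reals. *)
Definition property_Mstar : Prop :=
  forall (f g : dual X) (u : nat -> dual X), `|f| = `|g| ->
    (u : nat -> weak_star) @ \oo --> ((0 : dual X) : weak_star) ->
    limn_esup (fun n => `|f + u n|%:E) = limn_esup (fun n => `|g + u n|%:E).

End WeakStar.

Arguments szlenk_derivation {R} X e.
Arguments property_Mstar {R} X.

(* Closed norm balls with arbitrary centre; radius 0 is allowed. *)
Definition is_closed_ball {R : realType} {E : normedModType R} (S : set E) : Prop :=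
  exists (c : E) (r : R), 0 <= r /\ S = closed_ball_ Num.norm c r.

(* Main.v *)
(* Write [rho] for the sum of the values of the quartic along a sequence, so that
   the unit ball of the space is [rho <= 1], and let the quartic take the value 1
   at [t0].  The norm is equivalent to the l2 norm, hence the unit vectors are
   weakly null and the space is reflexive.  Since [rho] is asymptotically additive
   on weakly null perturbations, and [t |-> M (k t) / M t] is monotone for fixed
   [k], the derivation of order [eps] is, up to its boundary, the sublevel set
   [rho <= c] with [c = 1 - M (eps / 2 * t0) < 1].  This set is symmetric, so if
   it were a ball it would be centred at 0; but [rho (r w) = r ^ 4 p + r ^ 2 (1 - p)]
   for [rho w = 1], where [p] is the quartic part of [rho w], and [p] is larger for
   a multiple of one unit vector than for a multiple of a sum of two: for
   [0 < r < 1] the function [rho] is not constant on the sphere of radius [r].  The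
   same two directions, perturbed by a fixed multiple of the unit vectors, violate
   property M*. *)
Require Import Defs.
From HB Require Import structures.
From mathcomp Require Import all_boot all_order all_algebra.
From mathcomp Require Import all_classical all_reals all_analysis.
From mathcomp Require Import ring lra.

Import Order.TTheory GRing.Theory Num.Theory.
Import numFieldNormedType.Exports.

Set Implicit Arguments.
Unset Strict Implicit.
Unset Printing Implicit Defensive.

Local Open Scope classical_set_scope.
Local Open Scope ring_scope.

(** * The quartic function *)

Section Quartic.
Context {R : realType} {A B : R} (A0 : 0 < A) (B0 : 0 < B).
Local Notation M := (@quartic R A B).

Lemma quartic_ge0 t : 0 <= M t.
Proof. by rewrite addr_ge0// mulr_ge0 ?(ltW A0) ?(ltW B0) ?exprn_even_ge0. Qed.

Lemma quartic_norm t : M `|t| = M t.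
Proof. by rewrite /quartic -!normrX !ger0_norm ?exprn_even_ge0. Qed.

Lemma quarticN t : M (- t) = M t.
Proof. by rewrite -quartic_norm normrN quartic_norm. Qed.

Lemma quartic0 : M 0 = 0.
Proof. by rewrite /quartic !expr0n/= !mulr0 addr0. Qed.

Lemma quartic_le s t : 0 <= s -> s <= t -> M s <= M t.
Proof.
move=> s0 st; have t0 := le_trans s0 st.
by rewrite lerD// ler_wpM2l ?(ltW A0) ?(ltW B0)// lerXn2r.
Qed.

Lemma quartic_lt s t : 0 <= s -> s < t -> M s < M t.
Proof.
move=> s0 st; have t0 := le_lt_trans s0 st.
by rewrite ltrD// ltr_pM2l// ltrXn2r// nnegrE ltW.
Qed.

Lemma quartic_ler s t : 0 <= s -> 0 <= t -> (M s <= M t) = (s <= t).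
Proof.
move=> s0 t0; apply/idP/idP; last exact: quartic_le.
by apply: contraTT; rewrite -!ltNge; exact: quartic_lt.
Qed.

Lemma quartic_scale_le k t : 0 <= k <= 1 -> M (k * t) <= k * M t.
Proof.
move=> /andP[k0 k1].
have kX n : k ^+ n.+1 <= k by rewrite exprS ler_piMr// exprn_ile1.
rewrite /quartic !exprMn.
have -> : k * (A * t ^+ 4 + B * t ^+ 2) = A * (k * t ^+ 4) + B * (k * t ^+ 2) by ring.
rewrite lerD// ler_wpM2l ?(ltW A0) ?(ltW B0)//.
  by rewrite ler_wpM2r ?exprn_even_ge0.
by rewrite ler_wpM2r ?exprn_even_ge0.
Qed.

(** The degree of the quartic bounds its growth under dilation. This serves as a quantitative
    continuity of the modular in the scale. *)
Lemma quartic_scale_ge k t : 1 <= k -> M (k * t) <= k ^+ 4 * M t.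
Proof.
move=> k1; have k0 : 0 <= k by exact: le_trans k1.
rewrite /quartic !exprMn mulrDr.
rewrite (mulrCA _ A) (mulrCA _ B) lerD2l ler_wpM2l ?(ltW B0)//.
by rewrite ler_wpM2r ?sqr_ge0// ler_weXn2l.
Qed.

(* [1 / M s] is the value at the end point [t = s] of the ratio
   [M (t / (s / t0)) / M t], which increases with [`|t|]. *)
Lemma quartic_ratio_le (t0 s t : R) : M t0 = 1 -> 0 < t0 -> 0 < s -> s <= t0 ->
  `|t| <= s -> M (t / (s / t0)) <= M t / M s.
Proof.
move=> Mt0 t0_gt0 s0 st0 ts.
have Ms0 : 0 < M s by rewrite -quartic0 quartic_lt.
rewrite ler_pdivlMr// -subr_ge0 -[M t]mul1r -Mt0.
have -> : M t0 * M t - M (t / (s / t0)) * M s =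
    A * B * t ^+ 2 * t0 ^+ 2 * (s ^+ 2 - t ^+ 2) * (t0 ^+ 2 - s ^+ 2) / s ^+ 2.
  by rewrite /quartic; field; rewrite !gt_eqF.
have ts2 : t ^+ 2 <= s ^+ 2 by rewrite -real_normK ?num_real// lerXn2r ?nnegrE ?(ltW s0).
have st2 : s ^+ 2 <= t0 ^+ 2 by rewrite lerXn2r ?nnegrE ?(ltW s0) ?(ltW t0_gt0).
rewrite divr_ge0 ?sqr_ge0// mulr_ge0 ?subr_ge0// mulr_ge0 ?subr_ge0//.
by rewrite mulr_ge0 ?sqr_ge0// mulr_ge0 ?sqr_ge0// mulr_ge0 ?(ltW A0) ?(ltW B0).
Qed.

Lemma quartic_continuous : continuous (M : R -> R).
Proof.
move=> t; apply: cvgD; apply: cvgM; (try exact: cvg_cst); exact: exprn_continuous.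
Qed.

Lemma quartic_surj y : 0 <= y -> exists2 t, 0 <= t & M t = y.
Proof.
(* The end point satisfies [y <= B * b ^+ 2], because [(1 + s) ^+ 2 >= s] for [s = y / B]. *)
move=> y0; pose b := 1 + y / B.
have yB : 0 <= y / B by rewrite divr_ge0// ltW.
have b0 : 0 <= b by rewrite addr_ge0.
have [|t] := @IVT R M 0 b y b0 (continuous_subspaceT quartic_continuous).
  rewrite quartic0 ge_min y0/= le_max; apply/orP; right.
  rewrite /quartic (le_trans (_ : _ <= B * b ^+ 2))//; last first.
    by rewrite lerDr mulr_ge0 ?exprn_ge0// ltW.
  rewrite mulrC -ler_pdivrMr// expr2 /b; nra.
by rewrite in_itv/= => /andP[t0 _] Mt; exists t.
Qed.

Lemma quartic_surj_gt0 y : 0 < y -> exists2 t, 0 < t & M t = y.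
Proof.
move=> y0; have [t t0 Mt] := quartic_surj (ltW y0); exists t => //.
rewrite lt_neqAle t0 andbT; apply/eqP => t0E.
by move: Mt; rewrite -t0E quartic0 => yE; move: y0; rewrite -yE ltxx.
Qed.

Definition quartic_slope (t : R) : R := 4 * A * t ^+ 3 + 2 * B * t.

(** Convexity in tangent form: the gap is an explicit combination of squares, so the signs of [s]
    and [t] are free. *)
Lemma quartic_tangent (s t : R) :
  M s + quartic_slope s * (t - s) <= M t.
Proof.
rewrite -subr_ge0 [X in 0 <= X](_ : _ =
    A * ((t ^+ 2 - s ^+ 2) ^+ 2 + 2 * s ^+ 2 * (t - s) ^+ 2) + B * (t - s) ^+ 2).
  rewrite addr_ge0// mulr_ge0 ?sqr_ge0 ?(ltW A0) ?(ltW B0)//.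
  by rewrite addr_ge0// ?sqr_ge0// mulr_ge0 ?sqr_ge0// mulr_ge0 ?sqr_ge0.
by rewrite /quartic /quartic_slope; ring.
Qed.

End Quartic.

(** * The Luxemburg norm through finite partial sums *)

Section Ell.
Context {R : realType} {A B : R} (A0 : 0 < A) (B0 : 0 < B).
Local Notation M := (@quartic R A B).
Local Notation E := (ell_quartic A0 B0).
Implicit Types (x y : E) (a : nat -> R).

Definition modular_upto (n : nat) a : R := \sum_(0 <= k < n) M (a k).
Local Notation rho := modular_upto.

Lemma modular_le a m n : (m <= n)%N -> rho m a <= rho n a.
Proof.
move=> mn; rewrite /rho /modular_upto (big_cat_nat (leq0n m) mn)/= lerDl sumr_ge0// => k _.
exact: quartic_ge0.
Qed.

Lemma orlicz_modular_le1P l a : 0 < l ->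
  (orlicz_modular (quarticOrlicz A0 B0) l a <= 1)%E <->
  (forall n, rho n (fun k => a k / l) <= 1).
Proof.
move=> l0; pose u k := (M (a k / l))%:E.
have -> : orlicz_modular (quarticOrlicz A0 B0) l a = (\sum_(0 <= k <oo) u k)%E.
  apply: eq_eseriesr => k _; rewrite /u -[in RHS]quartic_norm normrM normfV.
  by rewrite [`|l|]gtr0_norm.
have u0 k : (0 <= u k)%E by rewrite lee_fin quartic_ge0.
have sE n : (\sum_(0 <= k < n) u k)%E = (rho n (fun k => a k / l))%:E.
  by rewrite sumEFin.
split=> [h n|h].
  rewrite -lee_fin -sE; apply: le_trans h.
  by apply: nneseries_lim_ge => k _.
apply: lime_le; first exact: is_cvg_nneseries.
by apply: nearW => n; rewrite sE lee_fin.
Qed.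

Lemma modular_scale_ge k n a : 1 <= k ->
  rho n (fun i => k * a i) <= k ^+ 4 * rho n a.
Proof.
by move=> k1; rewrite mulr_sumr; apply: ler_sum => i _; exact: quartic_scale_ge.
Qed.

(** The infimum in the Luxemburg norm is attained: every scale [(1 + e) * l] is admissible, and
    going back to [l] costs a factor [(1 + e) ^+ 4], which tends to 1. *)
Lemma ell_norm_leP x l : 0 < l ->
  `|x| <= l <-> forall n, rho n (fun k => x k / l) <= 1.
Proof.
move=> l0; set S := [set l | 0 < l /\ (orlicz_modular (quarticOrlicz A0 B0) l x <= 1)%E].
have xE : `|x| = inf S by [].
have Slb : has_lbound S by exists 0 => m [/ltW].
split=> [|h]; last first.
  by rewrite xE; apply: ge_inf => //; split=> //; exact/orlicz_modular_le1P.
move=> xl n; have key e : 0 < e -> rho n (fun k => x k / l) <= (1 + e) ^+ 4.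
  move=> e0; have ll : inf S < (1 + e) * l.
    by rewrite -xE (le_lt_trans xl)// ltr_pMl// ltrDl.
  have SN0 : S !=set0.
    have := orlicz_seqP x; rewrite inE/= => -[m m0 xm].
    set r := orlicz_modular _ _ _ in xm.
    have u0 k : (0 <= (quarticOrlicz A0 B0 (`|x k| / m))%:E)%E.
      by rewrite lee_fin quartic_ge0.
    have r0 : (0 <= r)%E by apply: nneseries_ge0 => k _ _; exact: u0.
    have rE : r = (fine r)%:E by rewrite fineK// ge0_fin_numE.
    have K1 : 1 <= fine r + 1 by rewrite lerDr fine_ge0.
    have K0 : 0 < fine r + 1 by exact: lt_le_trans K1.
    (* With [r] the modular at scale [m], enlarging the scale by [r + 1] brings it down to at most
       [r / (r + 1) <= 1], by convexity. *)
    exists ((fine r + 1) * m); split; first exact: mulr_gt0.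
    apply/orlicz_modular_le1P => [|j]; first exact: mulr_gt0.
    apply: (@le_trans _ _ ((fine r + 1)^-1 * fine r)); last first.
      by rewrite ler_pdivrMl// mulr1 lerDl.
    apply: (@le_trans _ _ ((fine r + 1)^-1 * rho j (fun k => `|x k| / m))).
      rewrite mulr_sumr; apply: ler_sum => k _; rewrite -quartic_norm.
      rewrite normrM normfV [X in _ / X]gtr0_norm ?mulr_gt0// [X in M X](_ : _ =
        (fine r + 1)^-1 * (`|x k| / m)); last by field; rewrite !gt_eqF.
      by apply: quartic_scale_le; rewrite // invr_ge0 ltW//= invf_le1.
    rewrite ler_pM2l ?invr_gt0// -lee_fin -rE -sumEFin.
    by apply: nneseries_lim_ge => k _ _; exact: u0.
  have [m [m0 /(orlicz_modular_le1P _ m0)/(_ n) xm] ml] := inf_lt SN0 ll.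
  have el0 : 0 < (1 + e) by rewrite addr_gt0.
  rewrite [X in rho n X](_ : _ = fun k => (1 + e) * (x k / ((1 + e) * l))); last first.
    by apply/funext => k; field; rewrite !gt_eqF.
  rewrite (le_trans (modular_scale_ge _ _ _))//; first by rewrite lerDl ltW.
  rewrite ler_piMr ?exprn_ge0 ?(ltW el0)//; apply: le_trans xm.
  apply: ler_sum => k _; rewrite -(quartic_norm (_ / _)) -[leRHS]quartic_norm.
  apply: quartic_le => //; rewrite !normrM !normfV ler_wpM2l//.
  by rewrite !gtr0_norm ?mulr_gt0// lef_pV2 ?posrE ?mulr_gt0// ltW.
apply/ler_addgt0Pr => e e0.
(* For [0 <= d <= 1] one has [(1 + d) ^+ 4 <= 1 + 15 * d], since [4 + 6 + 4 + 1 = 15]. *)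
pose d := Num.min 1 e / 15.
have m0 : 0 < Num.min 1 e by rewrite lt_min ltr01.
have d1 : d <= 15^-1 by rewrite ler_pdivrMr// mulVf// ge_min lexx.
have d0 : 0 < d by rewrite divr_gt0.
have de : 15 * d <= e by rewrite mulrC divfK// ge_min lexx orbT.
apply: (le_trans (key d d0)); apply: (@le_trans _ _ (1 + 15 * d)); last by rewrite lerD2l.
have d1' : d <= 1 by lra.
have -> : (1 + d) ^+ 4 = 1 + d * (4 + d * (6 + d * (4 + d))) by ring.
rewrite [15 * d]mulrC lerD2l ler_pM2l//; nra.
Qed.

Lemma ell_mem a C : (forall n, rho n a <= C) ->
  a \in orlicz_pred (quarticOrlicz A0 B0).
Proof.
move=> aC; rewrite inE/=; exists 1 => //.
apply: (@le_lt_trans _ _ C%:E); last exact: ltry.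
apply: lime_le.
  by apply: is_cvg_nneseries => k _ _; rewrite lee_fin quartic_ge0.
apply: nearW => n; rewrite sumEFin lee_fin; apply: le_trans (aC n).
by apply: ler_sum => k _; rewrite divr1/= quartic_norm.
Qed.

Lemma modular_unit_le m n u : rho n (fun k => (k == m)%:R * u) <= M u.
Proof.
have [mn|nm] := ltnP m n.
  rewrite /modular_upto (bigD1_seq m) ?mem_index_iota ?iota_uniq//= eqxx mul1r.
  rewrite big1 ?addr0// => k /negPf ->; rewrite mul0r; exact: quartic0.
rewrite /modular_upto big_nat_cond big1 ?quartic_ge0// => k /andP[/andP[_ kn] _].
by rewrite ltn_eqF ?mul0r ?quartic0// (leq_trans kn).
Qed.

Let unit_le m n : rho n (fun k => (k == m)%:R) <= M 1.
Proof.
by apply: le_trans (modular_unit_le m n 1); apply: ler_sum => k _; rewrite mulr1.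
Qed.

Definition ell_unit m : E := OrliczSpace (ell_mem (unit_le m)).
Local Notation e := ell_unit.

Definition ell_comb n a : E := \sum_(0 <= k < n) a k *: e k.

Lemma ell_coordD x y k : (x + y) k = x k + y k. Proof. by []. Qed.

Lemma ell_coord0 k : (0 : E) k = 0. Proof. by []. Qed.

Lemma ell_coordB x y k : (x - y) k = x k - y k. Proof. by []. Qed.

Lemma ell_coordZ t x k : (t *: x) k = t * x k. Proof. by []. Qed.

Lemma ell_combE n a k : ell_comb n a k = if (k < n)%N then a k else 0.
Proof.
rewrite /ell_comb; elim: n => [|n IHn]; first by rewrite big_geq.
rewrite big_nat_recr// ell_coordD IHn ell_coordZ ltnS [in RHS]leq_eqVlt [e n k]/=.
by have [->|] := eqVneq k n; rewrite ?ltnn ?mulr1 ?add0r ?mulr0 ?addr0.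
Qed.

Lemma ell_coord_le t0 x k : M t0 = 1 -> 0 < t0 -> `|x k| <= t0 * `|x|.
Proof.
move=> Mt0 t0_gt0; have [->|x0] := eqVneq x 0; first by rewrite !normr0 mulr0.
have nx0 : 0 < `|x| by rewrite normr_gt0.
have /(ell_norm_leP _ nx0)/(_ k.+1) xk := lexx `|x|.
rewrite -ler_pdivrMr// -(@quartic_ler _ _ _ A0 B0) ?divr_ge0 ?(ltW t0_gt0)// Mt0.
apply: le_trans xk; rewrite -[in leLHS](normr_id x) -normfV -normrM quartic_norm.
rewrite /modular_upto big_nat_recr// lerDr.
by apply: sumr_ge0 => i _; exact: quartic_ge0.
Qed.

(** The quadratic part of the modular alone controls the l2 norm; this is one half of the
    isomorphism with l2. *)
Lemma ell_sqr_le x n : \sum_(0 <= k < n) (x k) ^+ 2 <= `|x| ^+ 2 / B.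
Proof.
have [->|x0] := eqVneq x 0.
  rewrite [leLHS]big1 => [|k _]; last by rewrite ell_coord0 expr0n.
  by rewrite divr_ge0 ?sqr_ge0 ?(ltW B0).
have nx0 : 0 < `|x| by rewrite normr_gt0.
have /(ell_norm_leP _ nx0)/(_ n) xn := lexx `|x|.
rewrite ler_pdivlMr// -[leRHS]mulr1 -ler_pdivrMl ?exprn_gt0//; apply: le_trans xn.
rewrite mulr_suml mulr_sumr; apply: ler_sum => k _.
rewrite [leLHS](_ : _ = B * (x k / `|x|) ^+ 2); last by field; rewrite gt_eqF.
by rewrite lerDr mulr_ge0 ?exprn_even_ge0 ?(ltW A0).
Qed.

(** The other half of the isomorphism. Coordinates of [x / q] are at most 1 in modulus, so the
    quartic is at most [A + B] times the square; dividing by [D >= 1] gains [D ^+ 2 >= A + B]. *)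
Lemma ell_norm_le_l2 x q : 0 < q ->
  (forall n, \sum_(0 <= k < n) (x k) ^+ 2 <= q ^+ 2) -> `|x| <= (A + B + 1) * q.
Proof.
move=> q0 xq; set D := A + B + 1; have D1 : 1 <= D by move: A0 B0; rewrite /D; lra.
have D0 : 0 < D by exact: lt_le_trans D1.
apply/ell_norm_leP => [|n]; first exact: mulr_gt0.
apply: (@le_trans _ _ ((A + B) / D ^+ 2 * (\sum_(0 <= k < n) (x k / q) ^+ 2))).
  rewrite mulr_sumr; apply: ler_sum => k _; set t := x k / q.
  have t1 : t ^+ 2 <= 1.
    rewrite exprMn exprVn ler_pdivrMr ?exprn_gt0// mul1r; apply: le_trans (xq k.+1).
    by rewrite big_nat_recr//= lerDr sumr_ge0// => i _; exact: sqr_ge0.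
  have -> : x k / (D * q) = D^-1 * t by rewrite /t; field; rewrite !gt_eqF.
  rewrite /quartic mulrDl mulrDl lerD//; last first.
    by rewrite exprMn exprVn mulrA.
  rewrite exprMn exprVn mulrA ler_pM ?divr_ge0 ?exprn_even_ge0 ?(ltW A0)//.
    by rewrite ler_pM2l// lef_pV2 ?posrE ?exprn_gt0// ler_weXn2l.
  by rewrite (exprD t 2 2) ler_piMr ?sqr_ge0.
apply: (@le_trans _ _ ((A + B) / D ^+ 2)).
  rewrite ler_piMr ?divr_ge0 ?addr_ge0 ?(ltW A0) ?(ltW B0) ?sqr_ge0//.
  rewrite (eq_bigr (fun k => (x k) ^+ 2 / q ^+ 2)); last first.
    by move=> k _; rewrite exprMn exprVn.
  by rewrite -mulr_suml ler_pdivrMr ?exprn_gt0// mul1r.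
rewrite ler_pdivrMr ?exprn_gt0// mul1r expr2 (@le_trans _ _ D)// ?ler_peMl ?(ltW D0)//.
by rewrite lerDl.
Qed.

End Ell.

(** * Tails of summable sequences *)

Lemma summable_tail {R : realType} (q : nat -> R) (C : R) :
  (forall k, 0 <= q k) -> (forall n, \sum_(0 <= k < n) q k <= C) ->
  forall d, 0 < d -> exists N, forall n m, (N <= n)%N -> \sum_(n <= k < m) q k <= d.
Proof.
move=> q0 qC d d0; pose S := range (fun n => \sum_(0 <= k < n) q k).
have S0 : S !=set0 by exists (\sum_(0 <= k < 0) q k), 0%N.
have Sub : has_ubound S by exists C => _ [n _ <-].
have [_ [N _ <-] SN] := sup_adherent d0 (conj S0 Sub).
exists N => n m Nn; have [nm|mn] := leqP n m; last by rewrite big_geq ?ltW// ltnW.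
apply: (@le_trans _ _ (\sum_(N <= k < m) q k)).
  by rewrite (big_cat_nat Nn nm)/= lerDr sumr_ge0.
have : \sum_(0 <= k < m) q k <= sup S by apply: ub_le_sup => //; exists m.
rewrite (big_cat_nat (leq0n N) (leq_trans Nn nm))/=; move: SN; lra.
Qed.

Lemma square_summable_cvg0 {R : realType} (a : nat -> R) (C : R) :
  (forall n, \sum_(0 <= k < n) a k ^+ 2 <= C) -> a n @[n --> \oo] --> 0.
Proof.
move=> aC; apply/cvgr0Pnorm_le => d d0.
have [N NP] := summable_tail (fun k => sqr_ge0 (a k)) aC (exprn_gt0 2 d0).
exists N => // n /= Nn; have := NP n n.+1 Nn; rewrite big_nat1.
by rewrite -(real_normK (num_real (a n))) ler_pXn2r ?nnegrE ?(ltW d0).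
Qed.

(** * Duality *)

Section EllDual.
Context {R : realType} {A B : R} {A0 : 0 < A} {B0 : 0 < B}.
Local Notation M := (@quartic R A B).
Local Notation E := (ell_quartic A0 B0).
Local Notation rho := (@modular_upto R A B).
Local Notation e := (@ell_unit R A B A0 B0).
Local Notation comb := (@ell_comb R A B A0 B0).
Implicit Types (x y : E) (a : nat -> R) (f : dual E).

Let D : R := A + B + 1.

Let D_gt0 : 0 < D. Proof. by move: A0 B0; rewrite /D; lra. Qed.

Lemma dual_comb f n a : f (comb n a) = \sum_(0 <= k < n) a k * f (e k).
Proof. by rewrite linear_sum; apply: eq_bigr => k _; rewrite linearZ. Qed.

(** Testing [f] on the vector [y] of its own first [n] coefficients gives [f y = Q], while the
    comparison with l2 bounds [y] by [D * Num.sqrt Q]. *)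
Lemma dual_sqr_le f n : \sum_(0 <= k < n) f (e k) ^+ 2 <= (D * `|f|) ^+ 2.
Proof.
set Q := \sum_(0 <= k < n) _.
have Q0 : 0 <= Q by apply: sumr_ge0 => k _; exact: sqr_ge0.
have [->|Qn0] := eqVneq Q 0; first exact: sqr_ge0.
have sQ0 : 0 < Num.sqrt Q by rewrite sqrtr_gt0 lt_neqAle eq_sym Qn0.
have sqQ : Num.sqrt Q ^+ 2 = Q by exact: sqr_sqrtr.
pose y := comb n (fun k => f (e k)).
have yQ : `|y| <= D * Num.sqrt Q.
  apply: ell_norm_le_l2 => // m; rewrite sqQ.
  apply: (@le_trans _ _ (\sum_(0 <= k < m + n) (y k) ^+ 2)).
    rewrite (big_cat_nat (leq0n m) (leq_addr n m))/= lerDl.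
    by rewrite sumr_ge0// => k _; exact: sqr_ge0.
  rewrite (big_cat_nat (leq0n n) (leq_addl m n))/= [X in _ + X]big_nat_cond.
  rewrite [X in _ + X]big1 ?addr0//; last first.
    by move=> k /andP[/andP[nk _] _]; rewrite ell_combE ltnNge nk/= expr0n.
  by rewrite /Q !big_mkord; apply: ler_sum => k _; rewrite ell_combE ltn_ord.
have fy : f y = Q by rewrite dual_comb; apply: eq_bigr => k _; rewrite expr2.
have := dual_norm_ub f y; rewrite fy ger0_norm// -[dual_norm f]/(`|f|).
move=> /le_trans/(_ (ler_wpM2l (normr_ge0 f) yQ)).
rewrite mulrA -{1}sqQ expr2 ler_pM2r// => h.
by rewrite -sqQ lerXn2r ?nnegrE ?mulr_ge0 ?(ltW D_gt0) ?sqrtr_ge0// mulrC.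
Qed.

Lemma dual_unit_cvg0 f : f (e n) @[n --> \oo] --> 0.
Proof. exact: square_summable_cvg0 (dual_sqr_le f). Qed.

Lemma ell_coord_cvg0 x : x n @[n --> \oo] --> 0.
Proof. exact: square_summable_cvg0 (ell_sqr_le x). Qed.

(* The tail is named by an existential because simplification unfolds the
   coordinates of a difference. *)
Lemma ell_tailE x n : exists2 z : E, x - comb n x = z &
  forall k, z k = if (k < n)%N then 0 else x k.
Proof.
exists (x - comb n x) => // k.
by rewrite ell_coordB ell_combE; case: ifP; rewrite ?subrr ?subr0.
Qed.

Lemma ell_comb_approx x d : 0 < d ->
  exists N, forall n, (N <= n)%N -> `|x - comb n x| <= d.
Proof.
move=> d0; have dD : 0 < d / D by rewrite divr_gt0.
have [N NP] := summable_tail (fun k => sqr_ge0 (x k)) (ell_sqr_le x) (exprn_gt0 2 dD).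
exists N => n Nn.
have [z -> xE] := ell_tailE x n.
rewrite -[leRHS](@divfK _ D) ?gt_eqF// mulrC.
apply: ell_norm_le_l2 => // m; apply: le_trans (NP n m Nn).
have [mn|nm] := leqP m n.
  rewrite [leRHS]big_geq// big_nat_cond [leLHS]big1// => k /andP[/andP[_ km] _].
  by rewrite xE (leq_trans km) ?expr0n.
rewrite (big_cat_nat (leq0n n) (ltnW nm))/= big_nat_cond big1 ?add0r.
  by apply: ler_sum_nat => k /andP[nk _]; rewrite xE ltnNge nk.
by move=> k /andP[/andP[_ kn] _]; rewrite xE kn expr0n.
Qed.

(** By continuity of [f], an estimate that holds for infinitely many truncations of [x] passes to
    [x]. *)
Lemma dual_eq_bound f x b c : (forall N, exists2 n, (N <= n)%N &
  `|f (comb n x) - b| <= c) -> `|f x - b| <= c.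
Proof.
move=> h; apply/ler_addgt0Pr => d d0.
have f0 : 0 < `|f| + 1 by rewrite ltr_wpDl.
have [N NP] := ell_comb_approx x (divr_gt0 d0 f0).
have [n Nn bn] := h N.
rewrite (_ : f x - b = (f (comb n x) - b) + f (x - comb n x)); last first.
  by rewrite linearB/=; ring.
apply: (le_trans (ler_normD _ _)); rewrite lerD//.
apply: (le_trans (dual_norm_ub f _)); rewrite -[dual_norm f]/(`|f|).
apply: (@le_trans _ _ ((`|f| + 1) * (d / (`|f| + 1)))).
  by rewrite ler_pM ?NP// lerDl.
by rewrite mulrC divfK ?gt_eqF.
Qed.

(** * Coordinate functionals and reflexivity *)

Lemma ell_coord_continuous_linear k :
  (fun x : E => x k) \in @continuous_linear_pred R E.
Proof.
rewrite inE/=; have evl : linear (fun x : E => x k : R^o) by [].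
split=> //.
pose ev : {linear E -> R^o} :=
  HB.pack (fun x : E => x k : R^o) (GRing.isLinear.Build _ _ _ _ _ evl).
apply: (@bounded_linear_continuous _ _ _ ev); apply/linear_boundedP.
have [t0 t0_gt0 Mt0] := quartic_surj_gt0 A0 B0 ltr01.
exists t0; split=> [|r /ltW t0r x]; first by rewrite num_real.
by rewrite (le_trans (ell_coord_le x k Mt0 t0_gt0))// ler_wpM2r.
Qed.

Definition coord_form k : dual E := Dual (ell_coord_continuous_linear k).

Definition coord_comb n a : dual E := \sum_(0 <= k < n) a k *: coord_form k.

Lemma coord_combE n a x : coord_comb n a x = \sum_(0 <= k < n) a k * x k.
Proof.
rewrite /coord_comb; elim: n => [|n IHn]; first by rewrite !big_geq.
by rewrite !big_nat_recr//= -IHn.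
Qed.

(** The coordinate functionals span a norm-dense subspace of the dual, so an element of the bidual
    is determined by its values on them. *)
Lemma coord_comb_approx f d : 0 < d ->
  exists n, `|f - coord_comb n (fun k => f (e k))| <= d.
Proof.
(* A weighted arithmetic-geometric inequality replaces Cauchy-Schwarz. On the unit ball the squares
   of [x] sum to at most [B^-1], and the tail of those of [f] is made at most [c ^+ 2]; the total is
   [c / B + c = d]. *)
move=> d0; pose c := d / (B^-1 + 1).
have BV0 : 0 < B^-1 + 1 by rewrite ltr_wpDl// invr_ge0 ltW.
have c0 : 0 < c by rewrite divr_gt0.
have amgm (u v : R) : u * v <= c * u ^+ 2 + v ^+ 2 / c.
  rewrite -subr_ge0.
  rewrite [X in 0 <= X](_ : _ = c / 2 * ((u - v / c) ^+ 2 + u ^+ 2 + (v / c) ^+ 2)).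
    apply: mulr_ge0; first exact/ltW/divr_gt0.
    by rewrite addr_ge0 ?sqr_ge0// addr_ge0 ?sqr_ge0.
  by field; rewrite gt_eqF.
have [N NP] := summable_tail (fun k => sqr_ge0 (f (e k))) (dual_sqr_le f) (exprn_gt0 2 c0).
exists N; apply: ge_sup.
  by exists `|(f - coord_comb N (fun k => f (e k))) 0|; exists 0 => //=; rewrite normr0.
move=> _ [x /= x1 <-].
rewrite -[X in `|X|]/(f x - coord_comb N (fun k => f (e k)) x) coord_combE.
apply: dual_eq_bound => n0; exists (N + n0)%N; first exact: leq_addl.
rewrite dual_comb (big_cat_nat (leq0n N) (leq_addr n0 N))/=.
under [X in _ - X]eq_bigr do rewrite mulrC.
rewrite addrAC subrr add0r (le_trans (ler_norm_sum _ _ _))//.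
apply: (@le_trans _ _ (\sum_(N <= i < N + n0) (c * x i ^+ 2 + f (e i) ^+ 2 / c))).
  apply: ler_sum => i _; rewrite normrM -(real_normK (num_real (x i))).
  by rewrite -(real_normK (num_real (f (e i)))) amgm.
rewrite big_split/= -mulr_sumr -mulr_suml.
have -> : d = c * B^-1 + c ^+ 2 / c.
  by rewrite expr2 mulfK ?gt_eqF// -[X in _ + X]mulr1 -mulrDr divfK ?gt_eqF.
rewrite lerD//; last by rewrite ler_pM2r ?invr_gt0// NP.
rewrite ler_pM2l//; apply: (@le_trans _ _ (\sum_(0 <= i < N + n0) x i ^+ 2)).
  rewrite (big_cat_nat (leq0n N) (leq_addr n0 N))/= lerDr.
  by apply: sumr_ge0 => i _; exact: sqr_ge0.
apply: (le_trans (ell_sqr_le _ _)); rewrite ler_pdivrMr// mulVf ?gt_eqF//.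
by rewrite exprn_ile1.
Qed.

(* The supremum defining the bidual norm of [G] is tested on the functional
   whose coefficients are the slopes of the quartic at [G (coord_form k)]; the
   tangent inequality bounds its norm. *)
Lemma bidual_modular_le1 (G : dual (dual E)) n : `|G| <= 1 ->
  rho n (fun k => G (coord_form k)) <= 1.
Proof.
move=> G1; pose y k := G (coord_form k).
pose f := coord_comb n (fun k => @quartic_slope R A B (y k)).
have Gf : G f = \sum_(0 <= k < n) @quartic_slope R A B (y k) * y k.
  rewrite /f /coord_comb linear_sum; apply: eq_bigr => k _.
  by rewrite linearZ.
have fx x : `|x| <= 1 -> f x <= 1 - rho n y + G f.
  move=> /ell_norm_leP-/(_ ltr01)/(_ n) x1; rewrite coord_combE Gf.
  apply: le_trans (lerD (lerB x1 (lexx (rho n y))) (lexx _)).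
  rewrite -sumrB -big_split/=; apply: ler_sum => k _; rewrite divr1.
  by have := quartic_tangent A0 B0 (y k) (x k); lra.
have fn : `|f| <= 1 - rho n y + G f.
  apply: ge_sup; first by exists `|f 0|; exists 0 => //=; rewrite normr0.
  move=> _ [x /= x1 <-]; rewrite ler_norml fx// andbT -lerN2 opprK -linearN fx//.
  by rewrite normrN.
(* Combined with [fn], the terms [G f] cancel and leave the modular at most 1. *)
have : G f <= `|f|.
  rewrite (le_trans (ler_norm _))// (le_trans (dual_norm_ub G f))//.
  by rewrite -[dual_norm G]/(`|G|) ler_piMl.
by rewrite -/y; lra.
Qed.

(** The values of [G] on the coordinate functionals form a sequence of modular at most 1, hence a
    vector [y]; [G] and evaluation at [y] agree on a dense subspace. Points of the bidual ball can
    thus be handled as sequences. *)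
Lemma bidual_reflexive (G : dual (dual E)) : `|G| <= 1 ->
  exists2 y : E, G = evaluation _ y & forall n, rho n y <= 1.
Proof.
move=> G1; have yP n := bidual_modular_le1 n G1.
exists (OrliczSpace (ell_mem A0 B0 yP)) => //; set y := OrliczSpace _.
apply/val_inj/funext => f /=; apply/eqP; rewrite -subr_eq0 -normr_le0.
apply/ler_addgt0Pr => d d0; rewrite add0r.
have y0 : 0 < 1 + `|y| by rewrite ltr_pwDl.
have [n nd] := coord_comb_approx f (divr_gt0 d0 y0).
set fn := coord_comb _ _ in nd.
have Gfn : G fn = fn y.
  rewrite coord_combE /fn /coord_comb linear_sum; apply: eq_bigr => k _.
  by rewrite linearZ.
rewrite [G f - f y](_ : _ = G (f - fn) - (f - fn) y); last first.
  by rewrite -[(f - fn) y]/(f y - fn y) linearB/= Gfn; ring.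
apply: (le_trans (ler_normB _ _)).
have := dual_norm_ub G (f - fn); have := dual_norm_ub (f - fn) y.
rewrite -[dual_norm G]/(`|G|) -[dual_norm (f - fn)]/(`|f - fn|) => h1 h2.
apply: (le_trans (lerD h2 h1)).
apply: (@le_trans _ _ ((1 + `|y|) * `|f - fn|)); last first.
  by rewrite mulrC -ler_pdivlMr.
by rewrite mulrDl mul1r [`|y| * _]mulrC lerD// ler_piMl.
Qed.

(** No norming functional has to be exhibited: the lower bound follows from the modular estimate in
    the bidual, applied to the evaluation divided by a slightly larger number than its norm. *)
Lemma evaluation_norm x : `|evaluation E x| = `|x|.
Proof.
apply/eqP; rewrite eq_le; apply/andP; split.
  apply: ge_sup; first by exists `|evaluation E x 0|; exists 0 => //=; rewrite normr0.
  move=> _ [f /= f1 <-]; rewrite (le_trans (dual_norm_ub f x))//.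
  by rewrite -[dual_norm f]/(`|f|) ler_piMl.
apply/ler_addgt0Pr => d d0; set l := `|evaluation E x| + d.
have l0 : 0 < l by rewrite ltr_wpDl.
apply/ell_norm_leP => // n.
have /bidual_modular_le1-/(_ n) : `|l^-1 *: evaluation E x| <= 1.
  by rewrite normrZ normfV gtr0_norm// ler_pdivrMl// mulr1 lerDl ltW.
apply: le_trans; apply: ler_sum => k _.
by rewrite mulrC.
Qed.



(** * Comparing the modular with the norm; test vectors *)

Lemma ell_norm_le1P x : `|x| <= 1 <-> forall n, rho n x <= 1.
Proof.
rewrite ell_norm_leP//; split=> h n; apply: le_trans (h n); apply: ler_sum => k _;
  by rewrite divr1.
Qed.

Lemma modular_le_norm x n : `|x| <= 1 -> rho n x <= `|x|.
Proof.
move=> x1; have [->|x0] := eqVneq x 0.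
  by rewrite normr0 /modular_upto big1// => k _; exact: quartic0.
have nx0 : 0 < `|x| by rewrite normr_gt0.
have /(ell_norm_leP _ nx0)/(_ n) xn := lexx `|x|.
apply: (@le_trans _ _ (`|x| * rho n (fun k => x k / `|x|))); last by rewrite ler_piMr.
rewrite mulr_sumr; apply: ler_sum => k _.
rewrite -[X in M X <= _](@divfK _ `|x|) ?gt_eqF// mulrC.
by apply: quartic_scale_le; rewrite ?normr_ge0.
Qed.

Lemma modular_mem k n x : (k < n)%N -> M (x k) <= rho n x.
Proof.
move=> kn; apply: le_trans (modular_le _ _ _ kn) => //.
rewrite /modular_upto big_nat_recr// lerDr.
by apply: sumr_ge0 => i _; exact: quartic_ge0.
Qed.

(** Among vectors of modular at most [M s] the largest norm is that of [s] times a unit vector,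
    namely [s / t0]. The monotone ratio applies coordinatewise because each coordinate is at most
    [s] in modulus. *)
Lemma ell_norm_le_modular t0 s x : M t0 = 1 -> 0 < t0 -> 0 < s -> s <= t0 ->
  (forall n, rho n x <= M s) -> `|x| <= s / t0.
Proof.
move=> Mt0 t0_gt0 s0 st0 xs; apply/ell_norm_leP => [|n]; first exact: divr_gt0.
have Ms0 : 0 < M s by rewrite -(quartic0 (A:=A) (B:=B)) quartic_lt.
apply: (@le_trans _ _ (rho n x / M s)); last by rewrite ler_pdivrMr// mul1r.
rewrite mulr_suml; apply: ler_sum => k _; apply: quartic_ratio_le => //.
rewrite -(@quartic_ler _ _ _ A0 B0) ?(ltW s0)// quartic_norm.
exact: le_trans (modular_mem x (ltnSn k)) (xs k.+1).
Qed.

Lemma ell_unit_norm_le t0 k : M t0 = 1 -> 0 < t0 -> `|e k| <= t0^-1.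
Proof.
move=> Mt0 t0_gt0; apply/ell_norm_leP => [|n]; first by rewrite invr_gt0.
by rewrite invrK -Mt0; exact: modular_unit_le.
Qed.

Lemma ell_comb_norm_le t0 n a : M t0 = 1 -> 0 < t0 ->
  `|comb n a| <= (\sum_(0 <= k < n) `|a k|) / t0.
Proof.
move=> Mt0 t0_gt0; rewrite (le_trans (ler_norm_sum _ _ _))// mulr_suml.
by apply: ler_sum => k _; rewrite normrZ ler_wpM2l// ell_unit_norm_le.
Qed.

Lemma modular_tail_le n m x C : (forall k, rho k x <= C) ->
  rho m (x - comb n x) <= C - rho n x.
Proof.
move=> xC; have [z -> xE] := ell_tailE x n.
apply: (@le_trans _ _ (rho (n + m) z)).
  by apply: modular_le => //; exact: leq_addl.
rewrite -(lerD2l (rho n x)) addrCA subrr addr0.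
apply: le_trans (xC (n + m)%N).
rewrite /modular_upto !(big_cat_nat (leq0n n) (leq_addr m n))/=.
rewrite lerD2l big_nat_cond big1 ?add0r => [|k /andP[/andP[_ kn] _]]; last first.
  by rewrite xE kn quartic0.
by apply: ler_sum_nat => k /andP[nk _]; rewrite xE ltnNge nk.
Qed.

(** Overwriting a coordinate, rather than adding to it, makes the modular exactly additive. Far out
    this is a weakly null perturbation, since the coordinates of [x] tend to 0. *)
Lemma modular_replace x m n u : (m < n)%N ->
  rho n (x + (u - x m) *: e m) = rho n x - M (x m) + M u.
Proof.
move=> mn; have [w -> wE] : exists2 w : E, x + (u - x m) *: e m = w &
    forall k, w k = if k == m then u else x k.
  exists (x + (u - x m) *: e m) => // k; rewrite ell_coordD ell_coordZ [e m k]/=.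
  by case: eqVneq => [->|_]; rewrite ?mulr1 ?mulr0 ?addr0// addrC subrK.
have mi : m \in index_iota 0 n by rewrite mem_index_iota.
rewrite /modular_upto [in LHS](bigD1_seq m) ?iota_uniq//= wE eqxx.
rewrite [in RHS](bigD1_seq m) ?iota_uniq//= [M (x m) + _]addrC addrK addrC.
by congr (_ + _); apply: eq_bigr => k /negPf km; rewrite wE km.
Qed.

Lemma modular_replace_le x m n u C : (forall k, rho k x <= C) ->
  rho n (x + (u - x m) *: e m) <= C + M u.
Proof.
(* The range is enlarged past [m], so that the overwritten coordinate is certainly counted. *)
move=> xC; apply: (@le_trans _ _ (rho (n + m.+1) (x + (u - x m) *: e m))).
  by apply: modular_le => //; exact: leq_addr.
rewrite modular_replace ?lerD2r; last by rewrite addnS ltnS leq_addl.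
by rewrite lerBlDr ler_wpDr ?quartic_ge0.
Qed.

(** The cases [m = 1] and [m = 2] are the two directions whose quartic parts differ. *)
Definition flat m (s : R) : E := comb m (fun=> s).

Lemma modular_flat m s : rho m (flat m s) = m%:R * M s.
Proof.
rewrite /modular_upto big_mkord (eq_bigr (fun=> M s)) => [|k _]; last first.
  by rewrite ell_combE ltn_ord.
by rewrite sumr_const card_ord mulr_natl.
Qed.

Lemma modular_flat_le m s n : rho n (flat m s) <= m%:R * M s.
Proof.
rewrite -modular_flat; have [nm|mn] := leqP n m; first exact: modular_le.
rewrite /modular_upto (big_cat_nat (leq0n m) (ltnW mn))/= [X in _ + X]big_nat_cond.
rewrite [X in _ + X]big1 ?addr0// => k /andP[/andP[mk _] _].
by rewrite ell_combE ltnNge mk quartic0.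
Qed.

Lemma flat_norm m t s : (0 < m)%N -> 0 < t -> m%:R * M t = 1 -> 0 <= s ->
  `|flat m (s * t)| = s.
Proof.
move=> m0 t0 mt s0; have -> : flat m (s * t) = s *: flat m t.
  by rewrite /flat /ell_comb scaler_sumr; under eq_bigr do rewrite -scalerA.
rewrite normrZ ger0_norm//.
suff -> : `|flat m t| = 1 by rewrite mulr1.
have h1 : `|flat m t| <= 1.
  by apply/ell_norm_le1P => n; rewrite (le_trans (modular_flat_le _ _ _))// mt.
by apply/eqP; rewrite eq_le h1 -mt -modular_flat modular_le_norm.
Qed.

End EllDual.

(** The two sides are the modulars of [r] times the normalised flat vectors on one and on two
    coordinates. Spreading the mass lowers the quartic part, which shrinks faster under scaling by
    [r < 1]. *)
Lemma quartic_flat_lt {R : realType} {A B : R} (r t0 t1 : R) : 0 < A -> 0 < B ->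
  0 < r < 1 -> 0 < t0 -> 0 < t1 ->
  @quartic R A B t0 = 1 -> 2%:R * @quartic R A B t1 = 1 ->
  @quartic R A B (r * t0) < 2%:R * @quartic R A B (r * t1).
Proof.
move=> A0 B0 /andP[r0 r1] t0_gt0 t1_gt0 M0 M1.
have r42 : r ^+ 4 < r ^+ 2 by rewrite (exprD r 2 2) gtr_pMr ?exprn_gt0// exprn_ilt1// ltW.
(* Otherwise the quadratic parts would compare strictly the same way, contradicting the equality of
   the two modulars. *)
have t4 : 2 * t1 ^+ 4 < t0 ^+ 4.
  rewrite ltNge; apply/negP => t4.
  have t2 : t0 ^+ 2 < 2 * t1 ^+ 2.
    have t1_ge0 : 0 <= 2 * t1 ^+ 2 by rewrite ltW// mulr_gt0// exprn_gt0.
    rewrite -(@ltr_pXn2r _ 2)// ?nnegrE ?sqr_ge0//.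
    rewrite -exprM (le_lt_trans t4)// exprMn -exprM ltr_pM2r ?exprn_gt0//.
    by rewrite expr2; lra.
  suff : @quartic R A B t0 < 2%:R * @quartic R A B t1 by rewrite M0 M1 ltxx.
  rewrite /quartic.
  have -> : 2 * (A * t1 ^+ 4 + B * t1 ^+ 2) = A * (2 * t1 ^+ 4) + B * (2 * t1 ^+ 2).
    by ring.
  by apply: ler_ltD; rewrite ?ler_pM2l ?ltr_pM2l.
rewrite -subr_gt0 [ltRHS](_ : _ = (r ^+ 2 - r ^+ 4) * (A * (t0 ^+ 4 - 2 * t1 ^+ 4)) +
   r ^+ 2 * (2%:R * @quartic R A B t1 - @quartic R A B t0)).
  by rewrite M0 M1 subrr mulr0 addr0 mulr_gt0 ?subr_gt0// mulr_gt0 ?subr_gt0.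
by rewrite /quartic; ring.
Qed.

Lemma continuous_sum_nat {R : realType} {T : topologicalType}
    (F : nat -> T -> R) (n : nat) : (forall k, continuous (F k)) ->
  continuous (fun x => \sum_(0 <= k < n) F k x).
Proof.
move=> Fc; elim: n => [|n IHn] x.
  under eq_fun do rewrite big_geq//; exact: cvg_cst.
under eq_fun do rewrite big_nat_recr//=; apply: cvgD; [exact: IHn|exact: Fc].
Qed.

(** * Weak* continuity and convergence *)

Section WeakStar.
Context {R : realType} {X : normedModType R}.

Lemma weak_star_eval_continuous (x : X) :
  continuous (fun f : weak_star X => (f : dual X) x).
Proof.
move=> f; apply: (@continuous_comp _ _ _ (fun g : weak_star X => (g : {ptws X -> R}))
  (fun g : {ptws X -> R} => g x)); first exact: initial_continuous.
exact: proj_continuous.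
Qed.

Lemma weak_star_cvg (u : nat -> dual X) (f : dual X) :
  (forall x, u n x @[n --> \oo] --> f x) ->
  (u : nat -> weak_star X) @ \oo --> (f : weak_star X).
Proof.
move=> uf V /= [_ [[W Wo <-] Wf WV]].
have : {ptws, (fun n => (u n : X -> R)) @ \oo --> (f : X -> R)}.
  by apply/pointwise_cvgP.
move=> /(_ W) h; have : nbhs (f : {ptws X -> R}) W by exact: open_nbhs_nbhs.
by move=> /h [N _ NW]; exists N => // n /NW; exact: WV.
Qed.

End WeakStar.

(** * The Szlenk derivation *)

Section SzlenkEll.
Context {R : realType} {A B : R} {A0 : 0 < A} {B0 : 0 < B}.
Local Notation M := (@quartic R A B).
Local Notation E := (ell_quartic A0 B0).
Local Notation rho := (@modular_upto R A B).
Local Notation e := (@ell_unit R A B A0 B0).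
Local Notation comb := (@ell_comb R A B A0 B0).
Local Notation flat := (@flat R A B A0 B0).
Implicit Types (x y : E).
Context (t0 : R) (Mt0 : M t0 = 1) (t0_gt0 : 0 < t0).

Let M_gt0 s : 0 < s -> 0 < M (s / 2 * t0).
Proof.
by move=> s0; rewrite -(quartic0 (A:=A) (B:=B)) (quartic_lt A0 B0)// mulr_gt0// divr_gt0.
Qed.

(* Near [x] in the weak* topology the ball only leaves room for tails of modular
   at most [1 - rho n x], hence of norm less than [eps / 2]. *)
Lemma szlenk_modular_le eps x n : 0 < eps < 2 ->
  szlenk_derivation (dual E) eps (evaluation E x) ->
  rho n x <= 1 - M (eps / 2 * t0).
Proof.
move=> eps02 [_ hV]; have /andP[eps0 eps2] := eps02.
rewrite leNgt; apply/negP => xc.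
(* A midpoint gives [1 - rho n x < M s < M (eps / 2 * t0)]; the maximum with 0 keeps [b]
   positive. *)
pose b := (Num.max (1 - rho n x) 0 + M (eps / 2 * t0)) / 2.
have mM : Num.max (1 - rho n x) 0 < M (eps / 2 * t0).
  by rewrite gt_max M_gt0// andbT; move: xc; lra.
have m0 : 0 <= Num.max (1 - rho n x) 0 by rewrite le_max lexx orbT.
have m1 : 1 - rho n x <= Num.max (1 - rho n x) 0 by rewrite le_max lexx.
have [s s0 Ms] : exists2 s, 0 < s & M s = b.
  by apply: (quartic_surj_gt0 A0 B0); rewrite /b; move: mM m0; lra.
have xs : 1 - M s < rho n x by rewrite Ms /b; move: mM m1; lra.
have s_lt : s < eps / 2 * t0.
  rewrite ltNge -(quartic_ler A0 B0) ?(ltW s0) ?mulr_ge0 ?divr_ge0 ?(ltW eps0) ?(ltW t0_gt0)//.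
  by rewrite -ltNge Ms /b; move: mM; lra.
have s_le : s <= t0.
  by rewrite (le_trans (ltW s_lt))// ler_piMl ?(ltW t0_gt0)// ler_pdivrMr// mul1r ltW.
pose d := eps / 2 * t0 - s; have d0 : 0 < d by rewrite subr_gt0.
pose F (G : weak_star (dual E)) := \sum_(0 <= k < n) M ((G : dual (dual E)) (coord_form k)).
pose H (G : weak_star (dual E)) := \sum_(0 <= k < n) `|(G : dual (dual E)) (coord_form k) - x k|.
have coordc k : continuous
    (fun G : weak_star (dual E) => (G : dual (dual E)) (coord_form k)).
  exact: weak_star_eval_continuous.
have Fc : continuous F.
  apply: continuous_sum_nat => k G.
  apply: (@continuous_comp _ _ _ (fun G : weak_star (dual E) =>
    (G : dual (dual E)) (coord_form k)) M G); first exact: coordc.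
  exact: quartic_continuous.
have Hc : continuous H.
  apply: continuous_sum_nat => k G.
  apply: (@continuous_comp _ _ _ (fun G : weak_star (dual E) =>
    (G : dual (dual E)) (coord_form k)) (fun t : R => `|t - x k|) G); first exact: coordc.
  by apply: cvg_norm; apply: cvgB; [exact: cvg_id|exact: cvg_cst].
(* Both conditions involve finitely many evaluations. The first leaves modular less than [M s] for
   the tail of a point of the ball, the second keeps its head within [d] of that of [x] in the l1
   sense. *)
pose V : set (weak_star (dual E)) :=
  (F @^-1` [set t | 1 - M s < t]) `&` (H @^-1` [set t | t < d]).
have Vo : open V.
  apply: openI.
    by apply: open_comp => [G _|]; [exact: Fc|exact: open_gt].
  by apply: open_comp => [G _|]; [exact: Hc|exact: open_lt].
have Vx : V (evaluation E x : weak_star (dual E)).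
  split; first exact: xs.
  by rewrite /V /preimage /= /H big1// => k _; rewrite subrr normr0.
have := hV V Vo Vx; apply/negP; rewrite -leNgt.
apply: ge_ereal_sup => _ [G [G1 [GF GH]]] [K [K1 [KF KH]] <-].
rewrite lee_fin; have [y yE y1] := bidual_reflexive G1.
have [z zE z1] := bidual_reflexive K1.
move: GF GH KF KH; rewrite /preimage /F /H /= yE zE /= => yF yH zF zH.
have tail (w : E) : (forall n, rho n w <= 1) -> 1 - M s < rho n w ->
    `|w - comb n w| <= s / t0.
  move=> w1 wn; apply: ell_norm_le_modular => // m.
  by apply: le_trans (modular_tail_le _ _ w1) _; move: wn; lra.
rewrite (_ : evaluation E y - evaluation E z = evaluation E (y - z)); last first.
  by apply/val_inj/funext => f; rewrite /= linearB.
rewrite evaluation_norm.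
(* Two tails of norm at most [s / t0] each and a head of norm at most [2 * d / t0] add up to
   [eps]. *)
have -> : y - z = (y - comb n y) - (z - comb n z) + comb n (fun k => y k - z k).
  have -> : comb n (fun k => y k - z k) = comb n y - comb n z.
    by rewrite /ell_comb -sumrB; apply: eq_bigr => k _; rewrite scalerBl.
  by rewrite opprB addrACA subrK addrAC subrr add0r.
apply: (le_trans (ler_normD _ _)).
have yt := tail y y1 yF; have zt := tail z z1 zF.
have h1 := ler_normB (y - comb n y) (z - comb n z).
have h2 := @ell_comb_norm_le _ _ _ A0 B0 t0 n (fun k => y k - z k) Mt0 t0_gt0.
have h3 : \sum_(0 <= k < n) `|y k - z k| <= d + d.
  apply: (@le_trans _ _ (\sum_(0 <= k < n) (`|y k - x k| + `|z k - x k|))).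
    apply: ler_sum => k _; rewrite -[y k - z k](subrKA (x k)) [`|z k - _|]distrC.
    exact: ler_normD.
  by rewrite big_split/= lerD// ltW.
have h4 : (\sum_(0 <= k < n) `|y k - z k|) / t0 <= eps - 2 * (s / t0).
  rewrite ler_pdivrMr// (le_trans h3)// [leRHS](_ : _ = d + d)//.
  by rewrite /d; field; rewrite gt_eqF.
apply: (le_trans (lerD (le_trans h1 (lerD yt zt)) (le_trans h2 h4))).
by rewrite [leLHS](_ : _ = eps)//; ring.
Qed.

(** The spare modular [1 - c] allows a far coordinate to be set to [u] or [- u] with [M u = 1 - c].
    Both vectors stay in the ball and approach [x] weakly, yet differ by at least [2 * u / t0 > eps]
    in norm. *)
Lemma szlenk_of_modular_le eps c x : 0 < eps ->
  (forall n, rho n x <= c) -> c < 1 - M (eps / 2 * t0) ->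
  szlenk_derivation (dual E) eps (evaluation E x).
Proof.
move=> eps0 xc c_lt; have Me0 := M_gt0 eps0.
have c0 : 0 <= c by have := xc 0%N; rewrite /modular_upto big_geq.
split; first by rewrite /dual_ball/= evaluation_norm; apply/ell_norm_le1P => n;
  apply: le_trans (xc n) _; move: c_lt; lra.
move=> V Vo Vx.
have [u u0 Mu] : exists2 u, 0 < u & M u = 1 - c.
  by apply: (quartic_surj_gt0 A0 B0); move: c_lt; lra.
have u_gt : eps / 2 * t0 < u.
  rewrite ltNge -(quartic_ler A0 B0) ?(ltW u0) ?mulr_ge0 ?divr_ge0 ?(ltW eps0) ?(ltW t0_gt0)//.
  by rewrite -ltNge Mu; move: c_lt; lra.
pose w (s : R) m : E := x + (s - x m) *: e m.
have wx s : (fun m => evaluation E (w s m) : weak_star (dual E)) @ \oo -->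
    (evaluation E x : weak_star (dual E)).
  apply: weak_star_cvg => f.
  have -> : (fun m => evaluation E (w s m) f) = (fun m => f x + (s - x m) * f (e m)).
    by apply/funext => m; rewrite /= /w linearD/= linearZ.
  rewrite -[X in _ --> X]addr0 -(mulr0 (s - 0)).
  apply: cvgD; first exact: cvg_cst.
  apply: cvgM; last exact: dual_unit_cvg0.
  by apply: cvgB; [exact: cvg_cst|exact: ell_coord_cvg0].
have nV : nbhs (evaluation E x : weak_star (dual E)) V by exact: open_nbhs_nbhs.
have [N1 _ h1] := wx u V nV; have [N2 _ h2] := wx (- u) V nV.
(* One index must serve for both signs, since the difference is read off at coordinate [m]. *)
pose m := maxn N1 N2.
have w1 s n : M s = 1 - c -> rho n (w s m) <= 1.
  by move=> Ms; rewrite (le_trans (modular_replace_le _ _ _ xc))// Ms addrC subrK.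
have wB s : M s = 1 - c -> dual_ball (evaluation E (w s m)).
  by move=> Ms; rewrite /dual_ball/= evaluation_norm; apply/ell_norm_le1P => n; exact: w1.
apply: (@lt_le_trans _ _ (`|evaluation E (w u m) - evaluation E (w (- u) m)|%:E)); last first.
  apply: ereal_sup_ubound; exists (evaluation E (w u m)).
    by split; [exact: wB|apply: h1; rewrite /= leq_maxl].
  exists (evaluation E (w (- u) m)) => //.
  by split; [apply: wB; rewrite quarticN|apply: h2; rewrite /= leq_maxr].
rewrite (_ : _ - _ = evaluation E (w u m - w (- u) m)); last first.
  by apply/val_inj/funext => f; rewrite /= linearB.
rewrite evaluation_norm lte_fin -(ltr_pM2l t0_gt0).
apply: lt_le_trans (ell_coord_le _ m Mt0 t0_gt0).
rewrite ell_coordB /w !ell_coordD !ell_coordZ [e m m]/= eqxx !mulr1.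
rewrite (_ : _ - _ = 2 * u); last by ring.
by rewrite ger0_norm ?mulr_ge0 ?(ltW u0)//; move: u_gt; lra.
Qed.

End SzlenkEll.

(** * Bounds on upper limits *)

Lemma le_limn_esup {R : realType} (u : nat -> \bar R) (l : \bar R) (N : nat) :
  (forall n, (N <= n)%N -> l <= u n)%E -> (l <= limn_esup u)%E.
Proof.
move=> lu; apply: le_ereal_inf_tmp => _ [V [K _ KV] <-].
apply: (le_trans (lu (maxn N K) (leq_maxl _ _))).
by apply: ereal_sup_ubound; exists (maxn N K) => //; apply: KV; rewrite /= leq_maxr.
Qed.

Lemma limn_esup_le {R : realType} (u : nat -> \bar R) (l : \bar R) (N : nat) :
  (forall n, (N <= n)%N -> u n <= l)%E -> (limn_esup u <= l)%E.
Proof.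
move=> ul; apply: (@le_trans _ _ (ereal_sup (u @` [set n | (N <= n)%N]))).
  by apply: ereal_inf_lbound; exists [set n | (N <= n)%N] => //; exists N.
by apply: ge_ereal_sup => _ [n /= Nn <-]; exact: ul.
Qed.

Theorem proposition13 (R : realType) (A B : R) (A0 : 0 < A) (B0 : 0 < B) :
  (forall e : R, 0 < e < 2 ->
     ~ is_closed_ball (evaluation (ell_quartic A0 B0) @^-1`
                  szlenk_derivation (dual (ell_quartic A0 B0)) e)) /\
  ~ property_Mstar (dual (ell_quartic A0 B0)).
Proof.
pose E := ell_quartic A0 B0.
pose M := @quartic R A B; pose rho := @modular_upto R A B.
have [t0 t0_gt0 Mt0] := quartic_surj_gt0 A0 B0 ltr01.
have h2 : 0 < 2%:R^-1 :> R by rewrite invr_gt0.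
have [t1 t1_gt0 Mt1] := quartic_surj_gt0 A0 B0 h2.
have {}Mt1 : 2%:R * M t1 = 1 by rewrite /M Mt1 mulfV.
have Mt0' : 1%:R * M t0 = 1 by rewrite mul1r.
pose flat1 s : E := flat 1 s; pose flat2 s : E := flat 2 s.

(* The derivation is not a ball *)
split=> [eps eps02 [z [r [r0 SE]]]|].
  have /andP[eps0 eps2] := eps02.
  pose c := 1 - M (eps / 2 * t0).
  have e2t0 : 0 <= eps / 2 * t0 by rewrite ltW// mulr_gt0// divr_gt0.
  have c0 : 0 < c.
    rewrite subr_gt0 -[ltRHS]Mt0 (quartic_lt A0 B0)//.
    by rewrite gtr_pMl// ltr_pdivrMr// mul1r.
  have c1 : c < 1.
    rewrite gtrBl -(quartic0 (A:=A) (B:=B)) (quartic_lt A0 B0)//.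
    by rewrite mulr_gt0// divr_gt0.
  have ballP (x : E) : szlenk_derivation (dual E) eps (evaluation E x) <-> `|z - x| <= r.
    by have := congr1 (fun S => S x) SE; rewrite /preimage/closed_ball_/= => ->.
  (* The supposed ball is squeezed between the vectors of modular bounded by some [b < c] and those
     of modular at most [c]; the boundary is left undecided. *)
  have S_le (x : E) n : `|z - x| <= r -> rho n x <= c.
    by move=> /ballP; exact: szlenk_modular_le.
  have le_S (x : E) b : (forall n, rho n x <= b) -> b < c -> `|z - x| <= r.
    by move=> xb bc; apply/ballP; exact: (szlenk_of_modular_le Mt0 t0_gt0 eps0 xb bc).
  have z0 : z = 0.
    apply/eqP; apply: contraT => zn0; have nz0 : 0 < `|z| by rewrite normr_gt0.
    have rz0 : 0 < r + `|z| by rewrite ltr_wpDl.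
    pose y : E := (1 + r / `|z|) *: z.
    have yS : `|z - y| <= r.
      rewrite /y scalerDl scale1r opprD addrA subrr add0r normrN normrZ.
      by rewrite ger0_norm ?divr_ge0// divfK ?gt_eqF.
    (* The point [y] is the end of the ball on the ray through [z]. Its reflection shrunk by
       [th < 1] has modular at most [th * c < c], so it lies in the ball, but it equals
       [- (r / |z|) z], at distance [r + |z|] from [z]. *)
    pose th := r / (r + `|z|).
    have th0 : 0 <= th by rewrite divr_ge0 ?(ltW rz0).
    have th1 : th < 1 by rewrite ltr_pdivrMr// mul1r ltrDl.
    have : `|z - (- th) *: y| <= r.
      apply: (le_S _ (th * c)); last by rewrite gtr_pMl.
      move=> n; apply: (@le_trans _ _ (th * rho n y)); last by rewrite ler_wpM2l// S_le.
      rewrite mulr_sumr; apply: ler_sum => k _; rewrite ell_coordZ mulNr quarticN.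
      by apply: quartic_scale_le => //; rewrite th0 ltW.
    rewrite scaleNr opprK /y scalerA -[X in `|X + _|]scale1r -scalerDl normrZ.
    have -> : th * (1 + r / `|z|) = r / `|z|.
      by rewrite /th; field; rewrite !gt_eqF.
    rewrite ger0_norm ?addr_ge0 ?divr_ge0// mulrDl mul1r divfK ?gt_eqF//.
    by rewrite -subr_ge0; move: nz0; lra.
  have zB (x : E) : `|z - x| = `|x| by rewrite z0 sub0r normrN.
  (* Otherwise some multiple of a unit vector has modular below [c] and norm above [r]. *)
  have cr : c <= M (r * t0).
    rewrite leNgt; apply/negP => rc.
    have [a a0 Ma] : exists2 a, 0 <= a & M a = (M (r * t0) + c) / 2.
      apply: (quartic_surj A0 B0); rewrite divr_ge0// addr_ge0 ?(ltW c0)//.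
      exact: quartic_ge0.
    have ra : r * t0 < a.
      rewrite ltNge -(quartic_ler A0 B0) ?mulr_ge0 ?(ltW t0_gt0)// -ltNge.
      by rewrite -/M Ma; move: rc; lra.
    have : `|z - flat1 a| <= r.
      apply: (le_S _ (M a)) => [n|]; last by rewrite Ma; move: rc; lra.
      by have := @modular_flat_le R A B A0 B0 1 a n; rewrite mul1r.
    rewrite zB /flat1 -[a](@divfK _ t0) ?gt_eqF// flat_norm ?divr_ge0 ?(ltW t0_gt0)//.
    by rewrite ler_pdivrMr// leNgt ra.
  have r_gt0 : 0 < r.
    rewrite lt_neqAle r0 andbT eq_sym; apply/eqP => rE.
    by move: cr; rewrite rE mul0r /M quartic0 leNgt c0.
  (* The two-coordinate flat vector of norm [r] is in the ball. With [cr] this contradicts the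
     strict inequality between the two directions once [r < 1]. *)
  have rc : 2%:R * M (r * t1) <= c.
    rewrite -(@modular_flat R A B A0 B0); apply: S_le.
    by rewrite zB flat_norm.
  have r1 : r < 1.
    rewrite ltNge; apply/negP => r1; move: rc; rewrite leNgt => /negP; apply.
    rewrite (lt_le_trans c1)// -[leLHS]Mt1 ler_pM2l// quartic_le ?(ltW t1_gt0)//.
    by rewrite ler_peMl ?(ltW t1_gt0).
  have r01 : 0 < r < 1 by rewrite r_gt0.
  have := quartic_flat_lt A0 B0 r01 t0_gt0 t1_gt0 Mt0 Mt1.
  by rewrite ltNge (le_trans rc).

(* Failure of property M* *)
move=> Mstar.
have h01 : 0 < (2^-1 : R) < 1 by rewrite h2 invf_lt1// ltr1n.
have lt12 := quartic_flat_lt A0 B0 h01 t0_gt0 t1_gt0 Mt0 Mt1.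
rewrite -!/(M _) in lt12.
have Mx1 : 2%:R * M (2^-1 * t1) < 1.
  rewrite -[ltRHS]Mt1 ltr_pM2l// (quartic_lt A0 B0) ?mulr_ge0 ?(ltW t1_gt0)//.
  by rewrite gtr_pMl//; have /andP[] := h01.
(* The height [u] makes the modular of [y + u e_n] exactly 1 for large [n], while that of
   [x + u e_n] is at most [p < 1], although [x] and [y] both have norm [1 / 2]. *)
have [u u0 Mu] : exists2 u, 0 < u & M u = 1 - 2%:R * M (2^-1 * t1).
  by apply: (quartic_surj_gt0 A0 B0); rewrite subr_gt0.
pose x := flat1 (2^-1 * t0); pose y := flat2 (2^-1 * t1).
pose v n : dual (dual E) := u *: evaluation E (ell_unit A0 B0 n).
have xy : `|evaluation E x| = `|evaluation E y|.
  by rewrite !evaluation_norm /x /y /flat1 /flat2 !flat_norm// ltW.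
have v0 : (v : nat -> weak_star (dual E)) @ \oo --> ((0 : dual (dual E)) : weak_star (dual E)).
  apply: weak_star_cvg => f; rewrite -[X in _ --> X](mulr0 u).
  by apply: cvgM; [exact: cvg_cst|exact: dual_unit_cvg0].
have vE (w : E) n : w n = 0 ->
    evaluation E w + v n = evaluation E (w + (u - w n) *: ell_unit A0 B0 n).
  move=> wn; rewrite wn subr0; apply/val_inj/funext => f.
  by rewrite /= linearD linearZ.
have := Mstar _ _ _ xy v0; apply/eqP; rewrite lt_eqF//.
pose p := M (2^-1 * t0) + M u.
have p1 : p < 1 by rewrite /p Mu; move: lt12; lra.
have p0 : 0 <= p by rewrite addr_ge0// quartic_ge0.
(* Solves [p = 1 - 4 * (1 - q)], so that Bernoulli's inequality gives [p <= q ^+ 4]. Modular at most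
   [p] then forces norm at most [q], a bound below 1 uniform in [n]. *)
pose q := (p + 3) / 4.
have q1 : q < 1 by rewrite /q; move: p1; lra.
have q0 : 0 < q by rewrite /q; move: p0; lra.
have pq : p <= q ^+ 4.
  have -> : p = 1 - 4 * (1 - q) by rewrite /q; field.
  rewrite -subr_ge0.
  have -> : q ^+ 4 - (1 - 4 * (1 - q)) = (1 - q) ^+ 2 * ((q + 1) ^+ 2 + 2) by ring.
  by rewrite mulr_ge0 ?sqr_ge0// addr_ge0 ?sqr_ge0.
apply: (@le_lt_trans _ _ q%:E).
  apply: (@limn_esup_le _ _ _ 1) => n n1; rewrite lee_fin vE; last first.
    by rewrite /x /flat1 ell_combE ltnNge n1.
  rewrite evaluation_norm; apply/ell_norm_leP => // k.
  set w := _ + _.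
  rewrite [X in modular_upto _ X](_ : _ = (fun i => q^-1 * w i)); last first.
    by apply/funext => i; rewrite mulrC.
  rewrite (le_trans (modular_scale_ge B0 _ _ _))//; first by rewrite invf_ge1// ltW.
  rewrite exprVn ler_pdivrMl ?exprn_gt0// mulr1; apply: le_trans pq.
  apply: modular_replace_le => j.
  by have := @modular_flat_le R A B A0 B0 1 (2^-1 * t0) j; rewrite mul1r.
apply: (@lt_le_trans _ _ 1%:E); first by rewrite lte_fin.
apply: (@le_limn_esup _ _ _ 2) => n n2; rewrite lee_fin vE; last first.
  by rewrite /y /flat2 ell_combE ltnNge n2.
rewrite evaluation_norm; set w := (X in `|X|).
(* In the unit ball the norm dominates the modular, which here reaches 1 by coordinate [n]; hence
   the norm is at least 1. *)
have [w1|/ltW//] := leP `|w| 1.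
apply: le_trans (modular_le_norm n.+1 w1); rewrite /w modular_replace//.
rewrite [y n](_ : _ = 0); last by rewrite /y /flat2 ell_combE ltnNge n2.
rewrite quartic0 subr0 -lerBlDr -/M Mu opprB addrC subrK.
rewrite -(@modular_flat R A B A0 B0); apply: modular_le => //; exact: ltnW.
Qed.
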